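(* Let $\mathcal C\subseteq\mathbb C$ be a subfield, let $A\in\operatorname{GL}_d(\mathcal C(z))$ and let $q\in\mathcal C[z]$ be a $\phi$-minimal pole of $A$. Put $n=-\operatorname{ord}_q(A)$ and $\tilde A=q^nA$, so that $\operatorname{ord}_q(\tilde A)=0$. If $[A]_\phi$ is partially desingularizable at $q$ (in particular, if it is desingularizable at $q$), then there exists a positive integer $k$ such that $$\pi_q\bigl(\tilde A\,\phi^{-1}(\tilde A)\cdots\phi^{-k}(\tilde A)\bigr)=0.$$
   Context: $\phi$ is the $\mathcal C$-automorphism of $\mathcal C(z)$ with $\phi(z)=z+1$, applied entrywise to matrices. $[A]_\phi$ denotes the difference system $\phi(Y)=AY$. For $T\in\operatorname{GL}_d(\mathcal C(z))$ put $T[A]_\phi:=\phi(T^{-1})AT$. $\operatorname{Mat}_d(\mathcal C[z])$ is the set of $d\times d$ matrices with polynomial entries. For an irreducible $p\in\mathcal C[z]$, $\operatorname{ord}_p$ is the $p$-adic valuation on $\mathcal C(z)$ ($\operatorname{ord}_p(0)=+\infty$), and for a matrix $\operatorname{ord}_p(A)$ is the minimum of the orders of the entries. $\pi_q$ denotes the residue map from the local ring $\{f\in\mathcal C(z):\operatorname{ord}_q(f)\ge0\}$ onto $\mathcal C[z]/\langle q\rangle$ (reduction modulo $q$), applied entrywise to matrices. $\operatorname{den}(A)$ is the common denominator of the entries of $A$. An irreducible $q$ is a $\phi$-minimal pole of $A$ if $q\mid\operatorname{den}(A)$ and $\phi^j(q)\nmid\operatorname{den}(A)$ for all integers $j\ge1$.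 For a $\phi$-minimal pole $q$ of $A$, $[A]_\phi$ is partially desingularizable at $q$ if there exists $T\in\operatorname{GL}_d(\mathcal C(z))\cap\operatorname{Mat}_d(\mathcal C[z])$ such that $\operatorname{ord}_q(T[A]_\phi)>\operatorname{ord}_q(A)$ and $\operatorname{ord}_p(T[A]_\phi)\ge\operatorname{ord}_p(A)$ for every other irreducible polynomial $p\in\mathcal C[z]$; it is desingularizable at $q$ if moreover $T$ can be chosen with $\operatorname{ord}_q(T[A]_\phi)\ge0$. *)

(* Defs.v *)
From HB Require Import structures.
From mathcomp Require Import all_boot all_order all_algebra.
From mathcomp Require Import complex constructive_ereal reals.

Set Implicit Arguments.
Unset Strict Implicit.
Unset Printing Implicit Defensive.

Import Order.TTheory GRing.Theory Num.Theory.
Local Open Scope ring_scope.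

Notation "p %:F" := (@FracField.tofrac _ p) : ring_scope.

Section RationalFunctions.
Variable F : fieldType.
Local Notation Fz := {fraction {poly F}}.
Implicit Types (f : Fz) (p q : {poly F}).

(* [repr f] is an arbitrary numerator/denominator pair, hence the division by
   the gcd.  In particular [rnum 0 = 0] and [rden 0] is a nonzero constant. *)
Definition rnum f : {poly F} :=
  \n_(repr f) %/ gcdp \n_(repr f) \d_(repr f).
Definition rden f : {poly F} :=
  \d_(repr f) %/ gcdp \n_(repr f) \d_(repr f).

Definition phi_poly p : {poly F} := p \Po ('X + 1).
Definition phi f : Fz :=
  (rnum f \Po ('X + 1))%:F / (rden f \Po ('X + 1))%:F.
Definition phiV f : Fz :=
  (rnum f \Po ('X - 1))%:F / (rden f \Po ('X - 1))%:F.

(* For p irreducible and g != 0, the largest k such that p ^ k divides g; such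
   a k is smaller than [size g]. *)
Definition mult p (g : {poly F}) : nat :=
  \max_(k < size g | p ^+ k %| g) k.

Definition ord p f : \bar int :=
  if f == 0 then +oo%E
  else ((mult p (rnum f))%:Z - (mult p (rden f))%:Z)%:E.

Definition lcmp p q : {poly F} := (p * q) %/ gcdp p q.

(* C[z]/<q>; the library quotient requires a monic modulus, so q is replaced
   by its monic associate. *)
Definition residue_ring q := {poly %/ (lead_coef q)^-1 *: q}.

(* Meaningful only on the local ring { f | 0 <= ord q f }, where the class of
   [rden f] is invertible. *)
Definition residue q f : residue_ring q :=
  in_qpoly _ (rnum f) / in_qpoly _ (rden f).

Section Systems.
Variable d : nat.
Implicit Types A T : 'M[Fz]_d.

Definition ord_mx p A : \bar int :=
  \big[Order.min/+oo%E]_(i < d) \big[Order.min/+oo%E]_(j < d) ord p (A i j).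

Definition den A : {poly F} :=
  \big[lcmp/1]_(i < d) \big[lcmp/1]_(j < d) rden (A i j).

Definition residue_mx q A : 'M[residue_ring q]_d := map_mx (residue q) A.

(* T[A]_phi *)
Definition gauge T A : 'M[Fz]_d := map_mx phi (invmx T) *m A *m T.

Definition polynomial_mx T : Prop :=
  exists P : 'M[{poly F}]_d, T = map_mx (fun p => p%:F) P.

Definition phi_minimal_pole q A : Prop :=
  [/\ irreducible_poly q, q %| den A &
      forall j : nat, (1 <= j)%N -> ~~ (iter j phi_poly q %| den A)].

Definition improves_at q A T : Prop :=
  [/\ T \in unitmx, polynomial_mx T,
      (ord_mx q A < ord_mx q (gauge T A))%E &
      forall p, irreducible_poly p -> ~~ (p %= q) ->
        (ord_mx p A <= ord_mx p (gauge T A))%E].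

Definition partially_desingularizable q A : Prop :=
  exists T, improves_at q A T.

Definition desingularizable q A : Prop :=
  exists T, improves_at q A T /\ (0 <= ord_mx q (gauge T A))%E.

(* A phi^-1(A) ... phi^-k(A) *)
Definition backward_product A k : 'M[Fz]_d :=
  \big[mulmx/1%:M]_(i < k.+1) iter i (map_mx phiV) A.

End Systems.
End RationalFunctions.

(* Main.v *)
(* Put B := T[A]_phi, so that A T = phi(T) B, and let Bt := q^n B.  The product
   telescopes to
     At phi^-1(At) ... phi^-k(At)
       = phi(T) Bt phi^-1(Bt) ... phi^-k(Bt) phi^-k(T)^-1.
   All the factors are integral at q: phi(T) is polynomial; phi^-j(Bt) for
   j >= 1 because B has no pole at phi^j(q), by minimality of q; and
   phi^-k(T)^-1 as soon as phi^k(q) does not divide det T, which happens for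
   some k because the polynomials phi^k(q) are pairwise coprime.  Finally Bt
   vanishes modulo q by partial desingularization. *)
Require Import Defs.
From HB Require Import structures.
From mathcomp Require Import all_boot all_order all_algebra.
From mathcomp Require Import complex constructive_ereal reals.

Set Implicit Arguments.
Unset Strict Implicit.
Unset Printing Implicit Defensive.

Import Order.TTheory GRing.Theory Num.Theory.
Local Open Scope ring_scope.

Section Fractions.
Variable F : fieldType.
Local Notation Fz := {fraction {poly F}}.
Implicit Types (f g : Fz) (p q a b r : {poly F}).

(** * Numerators and denominators of rational functions *)

Lemma mulf_denom_repr f : f * (\d_(repr f))%:F = (\n_(repr f))%:F.
Proof.
have dn0 : \d_(repr f) != 0 by exact: denom_ratioP.
rewrite -{1}[f]reprK -{1}[repr f]Ratio_numden.
case: (RatioP _ _) => [d0|{}dn0]; first by rewrite d0 eqxx in dn0.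
(* In the quotient, the equality becomes an identity of cross products of representatives. *)
unlock FracField.tofrac; rewrite -[LHS]FracField.pi_mul; apply/eqmodP.
by rewrite /= FracField.equivfE /FracField.mulf /= !numden_Ratio
  ?mulr1 ?oner_eq0 ?mul1r // mulrC.
Qed.

Lemma gcd_repr_neq0 f : gcdp \n_(repr f) \d_(repr f) != 0.
Proof. by rewrite gcdp_eq0 (negbTE (denom_ratioP _)) andbF. Qed.

Lemma rden_neq0 f : rden f != 0.
Proof. by rewrite dvdp_div_eq0 ?dvdp_gcdr ?denom_ratioP. Qed.

Lemma rnum_div_rden f : (rnum f)%:F / (rden f)%:F = f.
Proof.
apply: (@mulIf _ (rden f)%:F); first by rewrite tofrac_eq0 rden_neq0.
rewrite divfK ?tofrac_eq0 ?rden_neq0 //.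
apply: (@mulIf _ (gcdp \n_(repr f) \d_(repr f))%:F).
  by rewrite tofrac_eq0 gcd_repr_neq0.
by rewrite -mulrA -!tofracM !divpK ?dvdp_gcdl ?dvdp_gcdr // mulf_denom_repr.
Qed.

Lemma eq_tofrac_div a b c d : b != 0 -> d != 0 ->
  (a%:F / b%:F == c%:F / d%:F :> Fz) = (a * d == c * b).
Proof. by move=> b0 d0; rewrite eqr_div ?tofrac_eq0 // -!tofracM tofrac_eq. Qed.

Lemma rnum_cross f a b : b != 0 -> f = a%:F / b%:F -> rnum f * b = a * rden f.
Proof.
move=> b0 fE; apply/eqP; rewrite -eq_tofrac_div ?rden_neq0 //.
by rewrite rnum_div_rden -fE.
Qed.

(* [phi] and [phiV] are convertible to [frac_comp ('X + 1)] and
   [frac_comp ('X - 1)]. *)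
Definition frac_comp r f : Fz := (rnum f \Po r)%:F / (rden f \Po r)%:F.

(** * Substitution of a linear polynomial in rational functions *)

Section FracComp.
Variable r : {poly F}.
Hypothesis r2 : size r = 2.

(** Independence of the chosen fraction: substitution preserves the cross-multiplied identity, and
    degree 1 of [r] keeps denominators nonzero. *)
Lemma frac_comp_div a b : b != 0 ->
  frac_comp r (a%:F / b%:F) = (a \Po r)%:F / (b \Po r)%:F.
Proof.
move=> b0; apply/eqP; rewrite eq_tofrac_div ?comp_poly2_eq0 ?rden_neq0 //.
by rewrite -!comp_polyM (rnum_cross b0 erefl).
Qed.

Lemma frac_comp_tofrac a : frac_comp r a%:F = (a \Po r)%:F.
Proof.
by rewrite -[a%:F]divr1 -tofrac1 frac_comp_div ?oner_eq0 // comp_polyC divr1.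
Qed.

Lemma frac_compB : zmod_morphism (frac_comp r).
Proof.
move=> f g; have Dn0 := comp_poly2_eq0 (rden _) r2.
rewrite -{1}[f]rnum_div_rden -{1}[g]rnum_div_rden -mulNr.
rewrite addf_div ?tofrac_eq0 ?rden_neq0 // -!(tofracM, tofracN, tofracD).
rewrite frac_comp_div ?mulf_neq0 ?rden_neq0 // /frac_comp.
rewrite -mulNr addf_div ?tofrac_eq0 ?Dn0 ?rden_neq0 //.
by rewrite comp_polyD !comp_polyM !(tofracM, tofracN, tofracD) rmorphN /= tofracN.
Qed.

Lemma frac_compM : monoid_morphism (frac_comp r).
Proof.
split=> [|f g]; first by rewrite -tofrac1 frac_comp_tofrac comp_polyC.
rewrite -{1}[f]rnum_div_rden -{1}[g]rnum_div_rden mulf_div -!tofracM.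
by rewrite frac_comp_div ?mulf_neq0 ?rden_neq0 // mulf_div !comp_polyM !tofracM.
Qed.
End FracComp.

Lemma size_Xadd1 : size ('X + 1 : {poly F}) = 2.
Proof. exact: (size_XaddC 1). Qed.

Lemma size_Xsub1 : size ('X - 1 : {poly F}) = 2.
Proof. exact: (size_XsubC 1). Qed.

HB.instance Definition _ :=
  GRing.isZmodMorphism.Build Fz Fz (@phi F) (frac_compB size_Xadd1).
HB.instance Definition _ :=
  GRing.isMonoidMorphism.Build Fz Fz (@phi F) (frac_compM size_Xadd1).
HB.instance Definition _ :=
  GRing.isZmodMorphism.Build Fz Fz (@phiV F) (frac_compB size_Xsub1).
HB.instance Definition _ :=
  GRing.isMonoidMorphism.Build Fz Fz (@phiV F) (frac_compM size_Xsub1).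

Lemma comp_Xadd1K p : (p \Po ('X + 1)) \Po ('X - 1) = p.
Proof. exact: comp_polyXaddC_K. Qed.

Lemma comp_Xsub1K p : (p \Po ('X - 1)) \Po ('X + 1) = p.
Proof. by have := comp_polyXaddC_K p (-1); rewrite polyCN opprK. Qed.

Lemma phiK : cancel (@phi F) (@phiV F).
Proof.
move=> f; rewrite -[LHS]/(frac_comp ('X - 1) (phi f)) frac_comp_div ?size_Xsub1 //.
  by rewrite !comp_Xadd1K rnum_div_rden.
by rewrite comp_poly2_eq0 ?size_Xadd1 // rden_neq0.
Qed.

(** * Irreducible polynomials, their shifts and their local rings *)

Lemma irreducible_phi_poly p :
  irreducible_poly p -> irreducible_poly (phi_poly p).
Proof.
case=> p_gt1 irr_p; split; first by rewrite size_comp_poly2 ?size_Xadd1.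
move=> d d1 dvd_d.
have: d \Po ('X - 1) %= p.
  apply: irr_p; first by rewrite size_comp_poly2 ?size_Xsub1.
  by rewrite -[p]comp_Xadd1K dvdp_comp_poly.
rewrite /eqp => /andP[h1 h2].
by rewrite -[d]comp_Xsub1K !dvdp_comp_poly.
Qed.

Lemma irreducible_dvdM p a b :
  irreducible_poly p -> (p %| a * b) = (p %| a) || (p %| b).
Proof.
move=> irr_p; have [pa|npa] := boolP (p %| a); first by rewrite dvdp_mulr.
by rewrite Gauss_dvdpr // irreducible_poly_coprime.
Qed.

Lemma irreducible_dvdX p a n :
  irreducible_poly p -> p %| a ^+ n -> p %| a.
Proof.
move=> irr_p; elim: n => [|n IHn]; last first.
  by rewrite exprS irreducible_dvdM // => /orP[].
by rewrite expr0 dvdp1; case: irr_p; case: (size p) => [|[]].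
Qed.

(** The local ring at [p], given by explicit fractions: closure under ring operations is then
    immediate. [ord_ge0P] links it to the order. *)
Definition locally_integral p f : Prop :=
  exists a b, ~~ (p %| b) /\ f = a%:F / b%:F.

Lemma ndvd_neq0 p b : ~~ (p %| b) -> b != 0.
Proof. by apply: contraNneq => ->; rewrite dvdp0. Qed.

Lemma locally_integral_tofrac p a : irreducible_poly p ->
  locally_integral p a%:F.
Proof.
move=> [p_gt1 _]; exists a, 1; rewrite tofrac1 divr1; split=> //.
by rewrite dvdp1 gtn_eqF.
Qed.

Lemma locally_integralD p f g : irreducible_poly p ->
  locally_integral p f -> locally_integral p g -> locally_integral p (f + g).
Proof.
move=> irr_p [a [b [nb ->]]] [c [d [nd ->]]].
exists (a * d + c * b), (b * d).
rewrite irreducible_dvdM // negb_or nb nd; split=> //.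
by rewrite addf_div ?tofrac_eq0 ?(ndvd_neq0 nb) ?(ndvd_neq0 nd) //
  !(tofracD, tofracM).
Qed.

Lemma locally_integralM p f g : irreducible_poly p ->
  locally_integral p f -> locally_integral p g -> locally_integral p (f * g).
Proof.
move=> irr_p [a [b [nb ->]]] [c [d [nd ->]]].
exists (a * c), (b * d).
by rewrite irreducible_dvdM // negb_or nb nd mulf_div !tofracM.
Qed.

(** Substituting ['X - 1] moves poles at [phi_poly p] to [p]: if [p] divided the new denominator,
    shifting back would make [phi_poly p] divide [b]. *)
Lemma locally_integral_phiV p f :
  locally_integral (phi_poly p) f -> locally_integral p (phiV f).
Proof.
move=> [a [b [nb ->]]]; exists (a \Po ('X - 1)), (b \Po ('X - 1)).
split; last by rewrite -frac_comp_div ?size_Xsub1 // (ndvd_neq0 nb).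
by apply: contra nb => /(dvdp_comp_poly ('X + 1)); rewrite comp_Xsub1K.
Qed.

Lemma locally_integral_iter_phiV p f k :
  locally_integral (iter k (@phi_poly F) p) f ->
  locally_integral p (iter k (@phiV F) f).
Proof.
elim: k p => //= k IHk p; rewrite -iterS iterSr => /IHk.
exact: locally_integral_phiV.
Qed.

(** Since [q] is a unit at [p], negative powers are allowed too. *)
Lemma locally_integral_expz p q (n : int) : irreducible_poly p ->
  ~~ (p %| q) -> locally_integral p (q%:F ^ n).
Proof.
move=> irr_p npq; have npqX k : ~~ (p %| q ^+ k).
  by apply: contra npq; apply: irreducible_dvdX.
case: n => k; first by rewrite -exprnP -tofracXn; apply: locally_integral_tofrac.
by exists 1, (q ^+ k.+1); rewrite tofrac1 div1r tofracXn.
Qed.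

(** * Multiplicity, order and residue *)

Lemma mult_spec p a : irreducible_poly p -> a != 0 ->
  exists a', a = p ^+ mult p a * a' /\ ~~ (p %| a').
Proof.
move=> irr_p a0; have [p_gt1 _] := irr_p.
(* The bound on the index in [mult] excludes no exponent: [p ^+ k] has degree at least k. *)
have lt_size k : p ^+ k %| a -> (k < size a)%N.
  move=> /(dvdp_leq a0); apply: leq_trans.
  rewrite [X in (_ < X)%N]polySpred ?expf_neq0 ?irredp_neq0 // size_exp ltnS.
  by rewrite leq_pmull // -ltnS prednK // ltnW.
have dvd_mult : p ^+ mult p a %| a.
  have a_gt0 : (0 < size a)%N by rewrite lt0n size_poly_eq0.
  rewrite /mult (bigop.bigmax_eq_arg (Ordinal a_gt0)) ?expr0 ?dvd1p //.
  by case: arg_maxnP; rewrite ?expr0 ?dvd1p.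
exists (a %/ p ^+ mult p a); split; first by rewrite mulrC divpK.
apply/negP => pa; have dvdS : p ^+ (mult p a).+1 %| a.
  by rewrite -[X in _ %| X](divpK dvd_mult) exprS dvdp_mul.
suff: (mult p a < mult p a)%N by rewrite ltnn.
by rewrite {2}/mult; apply: (bigop.bigmax_sup (Ordinal (lt_size _ dvdS))).
Qed.

Lemma ord_geP p f (m : int) : irreducible_poly p ->
  (m%:E <= ord p f)%E <-> locally_integral p (p%:F ^ (- m) * f).
Proof.
move=> irr_p; rewrite /ord; case: eqVneq => [->|f0].
  split=> [_|_]; last by rewrite leey.
  by rewrite mulr0 -tofrac0; apply: locally_integral_tofrac.
have num0 : rnum f != 0.
  by apply: contraNneq f0 => num0; rewrite -[f]rnum_div_rden num0 tofrac0 mul0r.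
have [a [aE npa]] := mult_spec irr_p num0.
have [b [bE npb]] := mult_spec irr_p (rden_neq0 f).
set mu := mult p (rnum f) in aE *; set nu := mult p (rden f) in bE *.
have p0 : p%:F != 0 :> Fz by rewrite tofrac_eq0 irredp_neq0.
(* Isolates the power of [p], with exponent the order of [f] minus [m]; the remaining factor [a / b]
   is a unit at [p]. *)
have -> : p%:F ^ (- m) * f = p%:F ^ (mu%:Z - nu%:Z - m) * (a%:F / b%:F).
  have fE : f = (p%:F ^ mu%:Z * a%:F) / (p%:F ^ nu%:Z * b%:F).
    by rewrite -!exprnP -!tofracXn -!tofracM -aE -bE rnum_div_rden.
  by rewrite {}fE invfM mulrACA invr_expz !expfzDr // [LHS]mulrCA -[RHS]mulrA.
rewrite lee_fin -subr_ge0; move: (_ - m) => e.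
case: e => e; split=> //.
- move=> _; rewrite -exprnP -tofracXn.
  by exists (p ^+ e * a), b; rewrite tofracM mulrA.
(* With a negative exponent, clearing denominators would make [p] divide [a * d], although it
   divides neither factor. *)
- move=> [c [d [npd]]]; rewrite NegzE -exprnN => /eqP.
  rewrite mulrA [_ * a%:F]mulrC -mulrA -invfM -tofracXn -tofracM.
  rewrite eq_tofrac_div ?mulf_neq0 ?expf_neq0 ?(irredp_neq0 irr_p) //;
    [|exact: ndvd_neq0 npb|exact: ndvd_neq0 npd].
  move=> /eqP eq_ad; have: p %| a * d.
    by rewrite eq_ad dvdp_mull // dvdp_mulr // exprS dvdp_mulr.
  by rewrite irreducible_dvdM // (negbTE npa) (negbTE npd).
Qed.

Lemma ord_ge0P p f : irreducible_poly p ->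
  (0 <= ord p f)%E <-> locally_integral p f.
Proof. by move=> irr_p; rewrite (ord_geP f 0 irr_p) oppr0 expr0z mul1r. Qed.

(** Already the class of the numerator vanishes: [q] divides [rnum] times [b] and is prime to
    [b]. *)
Lemma residue_maximal q f : irreducible_poly q -> locally_integral q f ->
  residue q (q%:F * f) = 0.
Proof.
move=> irr_q [a [b [nqb ->]]]; have b0 := ndvd_neq0 nqb.
have dvd_num : q %| rnum (q%:F * (a%:F / b%:F)).
  have fE : q%:F * (a%:F / b%:F) = (q * a)%:F / b%:F by rewrite tofracM mulrA.
  have: q %| rnum (q%:F * (a%:F / b%:F)) * b.
    by rewrite (rnum_cross b0 fE) dvdp_mulr // dvdp_mulr.
  by rewrite irreducible_dvdM // (negbTE nqb) orbF.
rewrite /residue; have -> : in_qpoly ((lead_coef q)^-1 *: q)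
    (rnum (q%:F * (a%:F / b%:F))) = 0; last by rewrite mul0r.
have lc0 : lead_coef q != 0 by rewrite lead_coef_eq0 irredp_neq0.
set h := _ *: q; have mon_h : h \is monic by rewrite monicE lead_coefZ mulVf.
have h_gt1 : (1 < size h)%N by rewrite size_scale ?invr_eq0 //; case: irr_q.
have /dvdpP[s ->] : h %| rnum (q%:F * (a%:F / b%:F)).
  by rewrite dvdpZl ?invr_eq0.
by apply/val_inj; rewrite /= /mk_monic h_gt1 mon_h Pdiv.RingMonic.rmodp_mull.
Qed.

(** * Common denominators and matrices over the local ring *)

Lemma dvdp_lcmpl a b : a %| lcmp a b.
Proof. by rewrite /lcmp -divp_mulA ?dvdp_gcdr // dvdp_mulr. Qed.

Lemma dvdp_lcmpr a b : b %| lcmp a b.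
Proof. by rewrite /lcmp mulrC -divp_mulA ?dvdp_gcdl // dvdp_mulr. Qed.

Lemma dvdp_biglcm (I : eqType) (s : seq I) (G : I -> {poly F}) i :
  i \in s -> G i %| \big[@lcmp F/1]_(j <- s) G j.
Proof.
elim: s => //= j s IHs; rewrite inE big_cons => /predU1P[->|/IHs dvd_i].
  exact: dvdp_lcmpl.
exact: dvdp_trans dvd_i (dvdp_lcmpr _ _).
Qed.

Lemma dvdp_rden_den d (A : 'M[Fz]_d) i j : rden (A i j) %| den A.
Proof.
apply: (@dvdp_trans _ (\big[@lcmp F/1]_(j < d) rden (A i j))).
  by apply: (dvdp_biglcm (fun j => rden (A i j))); rewrite mem_index_enum.
by apply: (dvdp_biglcm (fun i => \big[@lcmp F/1]_j rden (A i j)));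
  rewrite mem_index_enum.
Qed.

Lemma ord_mx_geP d p (A : 'M[Fz]_d) (m : \bar int) :
  (m <= ord_mx p A)%E <-> forall i j, (m <= ord p (A i j))%E.
Proof.
rewrite /ord_mx; split=> [/bigmin_geP[_ leA] i j|leA].
  by have /bigmin_geP[_ ->] := leA i isT.
apply/bigmin_geP; split=> [|i _]; first exact: leey.
by apply/bigmin_geP; split=> [|j _]; first exact: leey.
Qed.

(** Cramer's rule: the poles of the inverse lie among the factors of the determinant. *)
Lemma invmx_tofrac d (P : 'M[{poly F}]_d) i j : \det P != 0 ->
  invmx (map_mx (fun p => p%:F) P) i j = (\adj P i j)%:F / (\det P)%:F.
Proof.
move=> detP0; rewrite -[map_mx _ P]/(map_mx (@FracField.tofrac {poly F}) P).
rewrite /invmx unitmxE det_map_mx unitfE tofrac_eq0 detP0 -map_mx_adj !mxE.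
by rewrite mulrC.
Qed.

Lemma locally_integral_mulmx p m n k (M : 'M[Fz]_(m, n)) (N : 'M[Fz]_(n, k)) :
  irreducible_poly p ->
  (forall i j, locally_integral p (M i j)) ->
  (forall i j, locally_integral p (N i j)) ->
  forall i j, locally_integral p ((M *m N) i j).
Proof.
move=> irr_p intM intN i j; rewrite mxE.
apply: (big_ind (locally_integral p)) => [|f g|l _].
- by rewrite -tofrac0; apply: locally_integral_tofrac.
- exact: locally_integralD.
- exact: locally_integralM.
Qed.

(** * Iterated inverse shifts of matrices and telescoping products *)

Lemma iter_map_mx d k (h : Fz -> Fz) (M : 'M[Fz]_d) i j :
  iter k (map_mx h) M i j = iter k h (M i j).
Proof. by elim: k => //= k IHk; rewrite mxE IHk. Qed.

Lemma iter_map_mx_phiVM d k (M N : 'M[Fz]_d) :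
  iter k (map_mx (@phiV F)) (M *m N) =
  iter k (map_mx (@phiV F)) M *m iter k (map_mx (@phiV F)) N.
Proof. by elim: k => //= k ->; rewrite map_mxM. Qed.

Lemma iter_map_mx_phiV1 d k :
  iter k (map_mx (@phiV F)) 1%:M = 1%:M :> 'M[Fz]_d.
Proof. by elim: k => //= k ->; rewrite map_mx1. Qed.

Lemma iter_phiV_prodS d k (A : 'M[Fz]_d) :
  \big[mulmx/1%:M]_(i < k.+1) iter i (map_mx (@phiV F)) A =
  A *m map_mx (@phiV F) (\big[mulmx/1%:M]_(i < k) iter i (map_mx (@phiV F)) A).
Proof.
rewrite big_ord_recl; congr (_ *m _).
by rewrite (big_morph (map_mx (@phiV F)) (fun M N => map_mxM _ M N) (map_mx1 _ d)).
Qed.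

Lemma map_mx_phiK d (M : 'M[Fz]_d) :
  map_mx (@phiV F) (map_mx (@phi F) M) = M.
Proof. by apply/matrixP => i j; rewrite !mxE phiK. Qed.

(* The intermediate factors phi^-i(T) telescope. *)
Lemma iter_phiV_prod_gauge d k (A B T : 'M[Fz]_d) :
  A *m T = map_mx (@phi F) T *m B ->
  \big[mulmx/1%:M]_(i < k) iter i (map_mx (@phiV F)) A
    *m iter k (map_mx (@phiV F)) (map_mx (@phi F) T) =
  map_mx (@phi F) T *m \big[mulmx/1%:M]_(i < k) iter i (map_mx (@phiV F)) B.
Proof.
move=> AT; elim: k => [|k IHk]; first by rewrite !big_ord0 mul1mx mulmx1.
rewrite !iter_phiV_prodS iterS -mulmxA -map_mxM IHk map_mxM map_mx_phiK.
by rewrite mulmxA AT -mulmxA.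
Qed.

End Fractions.

(** * Shifts of a polynomial as divisors of a fixed one *)

Lemma horner_iter_phi_poly (K : fieldType) (p : {poly K}) k x :
  (iter k (@phi_poly K) p).[x] = p.[x + k%:R].
Proof.
elim: k x => [|k IHk] x; first by rewrite addr0.
by rewrite iterS horner_comp !hornerE IHk -addrA nat1r.
Qed.

(* If x is a root of q, then x - k is a root of phi^k(q), and these are
   pairwise distinct in characteristic 0. *)
Lemma iter_phi_poly_ndvd (C : fieldType) (K : numClosedFieldType)
    (iota : {rmorphism C -> K}) (q D : {poly C}) :
  (1 < size q)%N -> D != 0 ->
  exists k, (0 < k)%N /\ ~~ (iter k (@phi_poly C) q %| D).
Proof.
move=> q_gt1 D0.
have [x qx0] : exists x, root (map_poly iota q) x.
  by apply/closed_rootP; rewrite size_map_poly gtn_eqF.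
(* Testing [size D] shifts suffices: if all divided [D], it would have [size D] distinct roots, more
   than its degree. *)
have [/existsP[k ndvd]|/existsPn dvdD] :=
  boolP [exists k : 'I_(size D), ~~ (iter k.+1 (@phi_poly C) q %| D)].
  by exists k.+1.
pose rs := [seq x - (nat_of_ord k).+1%:R | k <- enum 'I_(size D)].
have: (size rs < size (map_poly iota D))%N.
  apply: max_poly_roots; first by rewrite map_poly_eq0.
  - apply/allP => _ /mapP[k _ ->].
    have /negPn := dvdD k; rewrite -(dvdp_map iota) => /dvdpP[s ->].
    rewrite rootM; apply/orP; right; rewrite /root.
    have -> : map_poly iota (iter k.+1 (@phi_poly C) q) =
        iter k.+1 (@phi_poly K) (map_poly iota q).
      elim: (k.+1) => // m IHm; rewrite !iterS {1}/phi_poly map_comp_poly.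
      by rewrite rmorphD /= map_polyX rmorph1 IHm.
    by rewrite horner_iter_phi_poly subrK.
  - rewrite map_inj_uniq ?enum_uniq // => i j /addrI/oppr_inj/eqP.
    by rewrite eqr_nat eqSS => /eqP/val_inj.
by rewrite size_map size_enum_ord size_map_poly ltnn.
Qed.

(** * Vanishing of the backward product modulo [q] *)

Theorem proposition3p12 (R : realType) (C : fieldType)
    (iota : {rmorphism C -> R[i]})
    (d : nat) (A : 'M[{fraction {poly C}}]_d) (q : {poly C}) (n : int) :
  A \in unitmx ->
  phi_minimal_pole q A ->
  n%:E = (- ord_mx q A)%E ->
  partially_desingularizable q A \/ desingularizable q A ->
  let At := q%:F ^ n *: A in
  exists k : nat, [/\ (0 < k)%N,
    (0 <= ord_mx q (backward_product At k))%E &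
    residue_mx q (backward_product At k) = 0].
Proof.
move=> _ [irr_q q_den min_q] ordA desing At.
have {desing} [T [Tunit [P TE] improv improv']] :
    partially_desingularizable q A by case: desing => // -[T []]; exists T.
have {}TE : T = map_mx (@FracField.tofrac {poly C}) P by [].
have detP0 : \det P != 0.
  by move: Tunit; rewrite unitmxE unitfE TE det_map_mx tofrac_eq0.
(* This choice of [k] makes phi^-k(T^-1) integral at [q]. *)
have [k [k_gt0 ndvd_k]] := iter_phi_poly_ndvd iota (irr_q.1) detP0.
exists k.
have irr_iter j : irreducible_poly (iter j (@phi_poly C) q).
  by elim: j => //= j; apply: irreducible_phi_poly.
pose B := gauge T A; pose Bt := q%:F ^ n *: B.
have AtT : At *m T = map_mx (@phi C) T *m Bt.
  rewrite -scalemxAl -scalemxAr /Bt /B /gauge !mulmxA -map_mxM mulmxV //.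
  by rewrite map_mx1 mul1mx.
have intA j : (0 < j)%N ->
    forall r s, locally_integral (iter j (@phi_poly C) q) (A r s).
  move=> j_gt0 r s; exists (rnum (A r s)), (rden (A r s)).
  rewrite rnum_div_rden; split=> //.
  apply: contra (min_q _ j_gt0) => dvd_j.
  exact: dvdp_trans dvd_j (dvdp_rden_den A r s).
have intBt j : (0 < j)%N ->
    forall r s, locally_integral q (iter j (map_mx (@phiV C)) Bt r s).
  move=> j_gt0 r s; rewrite iter_map_mx mxE.
  apply: locally_integral_iter_phiV.
  (* An associate of [q] would divide [den A], against minimality. Hence [q] is a unit at phi^j(q),
     and the gauge transformation does not lower the order there. *)
  have ndvd_q : ~~ (iter j (@phi_poly C) q %= q).
    by apply: contra (min_q _ j_gt0) => /eqp_dvdl ->.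
  apply: locally_integralM => //.
    apply: locally_integral_expz => //; apply: contra ndvd_q.
    by apply: (irr_q.2); rewrite gtn_eqF //; case: (irr_iter j).
  apply/ord_ge0P => //; move: r s; apply/ord_mx_geP.
  apply: le_trans (improv' _ (irr_iter j) ndvd_q); apply/ord_mx_geP => r s.
  by apply/ord_ge0P => //; apply: intA.
(* One factor [q] can be split off [Bt]: orders are integers or infinite, so a strict improvement
   over -n gives at least 1 - n. *)
pose Bq := q%:F ^ (n - 1) *: B.
have BtE : Bt = q%:F *: Bq.
  rewrite scalerA -{1}[q%:F]expr1z -expfzDr ?tofrac_eq0 ?irredp_neq0 //.
  by rewrite addrC subrK.
have intBq r s : locally_integral q (Bq r s).
  rewrite mxE -[n - 1]opprK; apply/ord_geP => //.
  move: r s; apply/ord_mx_geP; move: improv.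
  have -> : ord_mx q A = (- n)%:E by rewrite EFinN ordA oppeK.
  case: (ord_mx q (gauge T A)) => //= m; rewrite ?leey //.
  by rewrite lte_fin lee_fin opprB lez1D.
(* The tail phi^-1(Bt) ... phi^-k(Bt): the outer [phiV] shifts the indices 0..k-1 to 1..k. *)
pose W := map_mx (@phiV C) (\big[mulmx/1%:M]_(i < k) iter i (map_mx (@phiV C)) Bt).
have intW r s : locally_integral q (W r s).
  rewrite /W (big_morph (map_mx (@phiV C)) (fun M N => map_mxM _ M N)
    (map_mx1 _ d)).
  move: r s; apply: (big_ind (fun M : 'M_d =>
    forall r s, locally_integral q (M r s))) => [r s|M N|i _].
  - rewrite mxE -[1]tofrac1 -tofracMn; exact: locally_integral_tofrac.
  - exact: locally_integral_mulmx.
  - exact: (intBt i.+1).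
pose V := iter k (map_mx (@phiV C)) (invmx T).
have intV r s : locally_integral q (V r s).
  rewrite iter_map_mx TE invmx_tofrac //; apply: locally_integral_iter_phiV.
  by exists (\adj P r s), (\det P).
pose Q := map_mx (@phi C) T *m Bq *m W *m V.
have intQ r s : locally_integral q (Q r s).
  move: r s; do 3!apply: locally_integral_mulmx => //.
  move=> r s; rewrite TE !mxE -[phi _]/(frac_comp ('X + 1) _).
  rewrite frac_comp_tofrac ?size_Xadd1 //; exact: locally_integral_tofrac.
have prodE : backward_product At k = q%:F *: Q.
  have := iter_phiV_prod_gauge k.+1 AtT.
  (* With k+1 factors, the right-hand factor phi^-(k+1)(phi(T)) is phi^-k(T), which [V] cancels. *)
  rewrite iterSr map_mx_phiK [in RHS]iter_phiV_prodS -/W.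
  move=> /(congr1 (mulmx^~ V)) /=.
  rewrite -[LHS]mulmxA -iter_map_mx_phiVM mulmxV // iter_map_mx_phiV1 mulmx1.
  rewrite /backward_product => ->.
  by rewrite BtE /Q -!mulmxA -!scalemxAl -!scalemxAr.
split=> //.
  apply/ord_mx_geP => r s; rewrite prodE mxE; apply/ord_ge0P => //.
  by apply: locally_integralM => //; apply: locally_integral_tofrac.
apply/matrixP => r s; rewrite prodE mxE [X in residue _ X]mxE.
by rewrite [RHS]mxE residue_maximal.
Qed.
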